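(* Let $X$ and $Y$ be real Banach spaces, let $\varepsilon\ge 0$, and let $f:X\to Y$ be a nearsurjective $\varepsilon$-nearisometry with $f(0)=0$. Then there exists a bijective linear isometry $U:X\to Y$ such that $$\|f(x)-Ux\|\le 2\varepsilon\quad\text{for all }x\in X.$$ Hence $f$ is $2\varepsilon$-nearsurjective. The constant $2$ is the best possible: for every real $c<2$ there exist real Banach spaces $X,Y$, a number $\varepsilon\ge 0$ and a nearsurjective $\varepsilon$-nearisometry $f:X\to Y$ with $f(0)=0$ such that no bijective linear isometry $U:X\to Y$ satisfies $\|f(x)-Ux\|\le c\,\varepsilon$ for all $x\in X$.
   Context: All Banach spaces are real. For $\varepsilon\ge 0$, a map $f:X\to Y$ between Banach spaces (not assumed continuous or surjective) is an $\varepsilon$-nearisometry if $|\,\|f(x)-f(y)\|-\|x-y\|\,|\le\varepsilon$ for all $x,y\in X$. For $\delta\ge 0$, a map $f:X\to Y$ is $\delta$-nearsurjective if for every $y\in Y$ there is $x\in X$ with $\|f(x)-y\|\le\delta$; it is nearsurjective if it is $\delta$-nearsurjective for some $\delta\ge 0$. *)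

(* Defs.v *)
From HB Require Import structures.
From mathcomp Require Import all_boot all_order all_algebra.
From mathcomp Require Import all_classical all_reals all_analysis.

Set Implicit Arguments.
Unset Strict Implicit.
Unset Printing Implicit Defensive.

Import Order.TTheory GRing.Theory Num.Theory.
Import numFieldNormedType.Exports.

Local Open Scope ring_scope.

Definition near_isometry (R : realType) (X Y : normedModType R) (eps : R)
    (f : X -> Y) : Prop :=
  forall x y : X, `| `|f x - f y| - `|x - y| | <= eps.

(* The parameter delta is meant to be nonnegative; this is required where
   delta is introduced. *)
Definition near_surjective_by (R : realType) (X Y : normedModType R)
    (delta : R) (f : X -> Y) : Prop :=
  forall y : Y, exists x : X, `|f x - y| <= delta.

Definition near_surjective (R : realType) (X Y : normedModType R)
    (f : X -> Y) : Prop :=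
  exists2 delta : R, 0 <= delta & near_surjective_by delta f.

Definition is_isometry (R : realType) (X Y : normedModType R)
    (f : X -> Y) : Prop :=
  forall x y : X, `|f x - f y| = `|x - y|.

(* Main.v *)
(* If [f] is a near-isometry with near-inverse [h], conjugating [f] by the point
   reflections of [X] in the midpoint of [a], [b] and of [Y] in the midpoint of
   [f a], [f b] gives a near-isometry [swap \o h \o swap \o f] that almost fixes
   [a] and [b] and doubles the distance by which the midpoint is missed, while
   the constant [K] becomes [5 * K].  The defect being at most [`|a - b|] up to a
   multiple of the constant, [k] iterations bound it by
   [`|a - b| / 2 ^+ k + O(5 ^+ k * K)].  Hence [f (16 ^+ k *: x) / 16 ^+ k]
   converges, its limit [U] preserves midpoints and distances, so it is linear,
   and the limit associated with [h] inverts it.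
   For the sharp constant, compare the norms of [f z] and [f z - f x] with those
   of [z] and [z - x] for [z = N *: u], [N] large: this bounds the one-sided
   derivatives of the norm at [u], giving
   [2 * `|u| <= `|u + t *: x| + `|U u - t *: f x| + 2 * eps * t].
   Take [w] with [U w = f x - U x] and [u] close to [w] such that the norm is
   almost differentiable at [u] in the direction [x]; then [`|w| <= 2 * eps].
   On the line, folding back the segment [0, 1/2] shows that 2 is optimal. *)
Require Import Defs.
From HB Require Import structures.
From mathcomp Require Import all_boot all_order all_algebra.
From mathcomp Require Import all_classical all_reals all_analysis.
From mathcomp Require Import ring lra.

Set Implicit Arguments.
Unset Strict Implicit.
Unset Printing Implicit Defensive.

Import Order.TTheory GRing.Theory Num.Theory.
Import numFieldNormedType.Exports.

Local Open Scope classical_set_scope.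
Local Open Scope ring_scope.

(** * Near-inverses of near-isometries *)

Definition near_inverses (R : realType) (X Y : normedModType R) (K : R)
    (f : X -> Y) (h : Y -> X) : Prop :=
  [/\ near_isometry K f, near_isometry K h,
      forall x, `|h (f x) - x| <= K & forall y, `|f (h y) - y| <= K].

Lemma near_inverses_sym (R : realType) (X Y : normedModType R) (K : R)
    (f : X -> Y) (h : Y -> X) :
  near_inverses K f h -> near_inverses K h f.
Proof. by case. Qed.

Lemma near_inverses_ge0 (R : realType) (X Y : normedModType R) (K : R)
    (f : X -> Y) (h : Y -> X) :
  near_inverses K f h -> 0 <= K.
Proof. by case=> _ _ /(_ 0) + _; apply: le_trans. Qed.

Lemma near_isometry_le (R : realType) (X Y : normedModType R) (K : R)
    (f : X -> Y) (x y : X) :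
  near_isometry K f -> `|f x - f y| <= `|x - y| + K.
Proof. by move=> /(_ x y); rewrite ler_norml => /andP[_]; lra. Qed.

Lemma near_isometry_ge (R : realType) (X Y : normedModType R) (K : R)
    (f : X -> Y) (x y : X) :
  near_isometry K f -> `|x - y| <= `|f x - f y| + K.
Proof. by move=> /(_ x y); rewrite ler_norml => /andP[+ _]; lra. Qed.

(** Choice gives approximate preimages [h y]. A distance between two of them suffers [eps] once and
    [d] at either end, hence [eps + 2 * d], which also covers both cancellation errors. *)
Lemma near_surjective_near_inverse (R : realType) (X Y : normedModType R)
    (eps : R) (f : X -> Y) :
  near_isometry eps f -> near_surjective f ->
  exists K (h : Y -> X), near_inverses K f h.
Proof.
move=> fi [d d0 /choice[h hP]]; exists (eps + 2 * d), h.
have eps0 : 0 <= eps by apply: le_trans (fi 0 0).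
split=> [x y|x y|x|y].
- by have := fi x y; lra.
- have := fi (h x) (h y); rewrite !ler_norml => /andP[h1 h2].
  have := hP x; have := hP y => hy hx.
  have := ler_distD (f (h x)) x y.
  have := ler_distD (f (h y)) (f (h x)) y.
  have := ler_distD x (f (h x)) (f (h y)).
  have := ler_distD y x (f (h y)).
  rewrite (distrC x (f (h x))) (distrC y (f (h y))) => *.
  by apply/andP; split; lra.
- by have := near_isometry_ge (h (f x)) x fi; have := hP (f x); lra.
- by have := hP y; lra.
Qed.

(** * Point reflections and conjugation by them *)

Definition swap (R : realType) (X : normedModType R) (a b x : X) : X :=
  a + b - x.

Lemma swapK (R : realType) (X : normedModType R) (a b : X) :
  involutive (swap a b).
Proof. by move=> x; rewrite /swap subKr. Qed.

Lemma swap_dist (R : realType) (X : normedModType R) (a b x y : X) :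
  `|swap a b x - swap a b y| = `|x - y|.
Proof. by rewrite /swap addrC opprB addrA subrK distrC. Qed.

Lemma swap_distC (R : realType) (X : normedModType R) (a b x y : X) :
  `|swap a b x - y| = `|x - swap a b y|.
Proof. by rewrite -(swap_dist a b) swapK. Qed.

Lemma swapl (R : realType) (X : normedModType R) (a b : X) : swap a b a = b.
Proof. by rewrite /swap addrC addKr. Qed.

Lemma swapr (R : realType) (X : normedModType R) (a b : X) : swap a b b = a.
Proof. by rewrite /swap addrK. Qed.

Definition midpoint (R : realType) (X : normedModType R) (a b : X) : X :=
  2^-1 *: (a + b).

Lemma swap_midpoint (R : realType) (X : normedModType R) (a b : X) :
  swap a b (midpoint a b) = midpoint a b.
Proof.
rewrite /swap /midpoint -[X in X - _]scale1r -scalerBl; congr (_ *: _); lra.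
Qed.

Lemma swap_sub (R : realType) (X : normedModType R) (a b x : X) :
  `|swap a b x - x| = 2 * `|x - midpoint a b|.
Proof.
rewrite distrC -[2]gtr0_norm // -normrZ; congr `|_|.
rewrite /swap /midpoint scalerBr scalerA divff // scale1r scaler_nat mulr2n.
by rewrite opprB addrA.
Qed.

(** The targets [a'], [b'] are left free because two choices occur: first [f a], [f b], to obtain a
    self-map of [X], then [a], [b] throughout the iteration. *)
Definition double_swap (R : realType) (X Y : normedModType R) (f : X -> Y)
    (h : Y -> X) (a b : X) (a' b' : Y) (x : X) : X :=
  swap a b (h (swap a' b' (f x))).

Definition double_swap_inv (R : realType) (X Y : normedModType R) (f : X -> Y)
    (h : Y -> X) (a b : X) (a' b' : Y) (x : X) : X :=
  h (swap a' b' (f (swap a b x))).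

Section DoubleSwap.
Variables (R : realType) (X Y : normedModType R) (K : R).
Variables (f : X -> Y) (h : Y -> X) (a b : X) (a' b' : Y).
Hypothesis fh : near_inverses K f h.
Hypotheses (fa : `|f a - a'| <= K) (fb : `|f b - b'| <= K).

Local Notation g := (double_swap f h a b a' b').
Local Notation g' := (double_swap_inv f h a b a' b').

(** Distances change by at most [2 * K] under [g], hence also under [g'], which is [g] conjugated by
    [swap a b]; the cancellations cost [3 * K]. The factor 5 leaves room for the [4 * K] by which
    [g] moves [a] and [b]. *)
Lemma double_swap_near_inverses : near_inverses (5 * K) g g'.
Proof.
have [fi hi hf fhK] := fh.
have K0 := near_inverses_ge0 fh.
have i1 x y : `|g x - g y| <= `|x - y| + 2 * K.
  rewrite /double_swap swap_dist.
  have := near_isometry_le (swap a' b' (f x)) (swap a' b' (f y)) hi.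
  by rewrite swap_dist; have := near_isometry_le x y fi; lra.
have i2 x y : `|x - y| <= `|g x - g y| + 2 * K.
  rewrite /double_swap swap_dist.
  have := near_isometry_ge (swap a' b' (f x)) (swap a' b' (f y)) hi.
  by rewrite swap_dist; have := near_isometry_ge x y fi; lra.
have gg' x : g' x = swap a b (g (swap a b x)).
  by rewrite /double_swap_inv /double_swap swapK.
split=> [x y|x y|x|x].
- by rewrite ler_norml; have := i1 x y; have := i2 x y => *; apply/andP; split; lra.
- rewrite !gg' swap_dist -(swap_dist a b x y) ler_norml.
  have := i1 (swap a b x) (swap a b y); have := i2 (swap a b x) (swap a b y).
  by move=> *; apply/andP; split; lra.
- rewrite /double_swap_inv /double_swap swapK; set y := swap a' b' (f x).
  have := ler_distD (h (swap a' b' y)) (h (swap a' b' (f (h y)))) x.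
  have := near_isometry_le (swap a' b' (f (h y))) (swap a' b' y) hi.
  by rewrite swap_dist; have := fhK y; have := hf x; rewrite {3 4}/y swapK; lra.
- rewrite /double_swap_inv /double_swap swap_distC; set z := swap a b x.
  set y := swap a' b' (f z).
  have := ler_distD (h (swap a' b' y)) (h (swap a' b' (f (h y)))) z.
  have := near_isometry_le (swap a' b' (f (h y))) (swap a' b' y) hi.
  by rewrite swap_dist; have := fhK y; have := hf z; rewrite {3 4}/y swapK; lra.
Qed.

Lemma double_swap_fixl : `|g a - a| <= 5 * K.
Proof.
have [fi hi hf fhK] := fh.
have K0 := near_inverses_ge0 fh.
rewrite /double_swap swap_distC swapl.
have := ler_distD (h (f b)) (h (swap a' b' (f a))) b.
have := near_isometry_le (swap a' b' (f a)) (f b) hi.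
have := ler_distD b' (swap a' b' (f a)) (f b).
rewrite (swap_distC a' b' (f a) b') swapr (distrC b' (f b)).
by have := hf b; have := fa; have := fb; lra.
Qed.

Lemma double_swap_fixr : `|g b - b| <= 5 * K.
Proof.
have [fi hi hf fhK] := fh.
have K0 := near_inverses_ge0 fh.
rewrite /double_swap swap_distC swapr.
have := ler_distD (h (f a)) (h (swap a' b' (f b))) a.
have := near_isometry_le (swap a' b' (f b)) (f a) hi.
have := ler_distD a' (swap a' b' (f b)) (f a).
rewrite (swap_distC a' b' (f b) a') swapl (distrC a' (f a)).
by have := hf a; have := fa; have := fb; lra.
Qed.

(** With [z] the midpoint of [a] and [b], [swap a' b'] moves [f z] by twice its distance to the
    target midpoint; [h] keeps this displacement up to [K], and [h (f z)] is within [K] of [z]. *)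
Lemma double_swap_defect :
  2 * `|f (midpoint a b) - midpoint a' b'|
    <= `|g (midpoint a b) - midpoint a b| + 2 * K.
Proof.
have [fi hi hf fhK] := fh.
rewrite /double_swap swap_distC swap_midpoint -swap_sub; set z := midpoint a b.
have := near_isometry_ge (swap a' b' (f z)) (f z) hi.
have := ler_distD z (h (swap a' b' (f z))) (h (f z)).
by rewrite (distrC z); have := hf z; lra.
Qed.

End DoubleSwap.

(** * Approximate preservation of midpoints *)

(** Induction on [k]: a double swap halves the defect and turns [K] into [5 * K]. The start is the
    triangle inequality through [a]. *)
Lemma near_fixed_midpoint (R : realType) (X : normedModType R) (a b : X)
    (k : nat) (K : R) (g h : X -> X) :
  near_inverses K g h -> `|g a - a| <= K -> `|g b - b| <= K ->
  `|g (midpoint a b) - midpoint a b| <= `|a - b| / 2 ^+ k + 2 * 5 ^+ k * K.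
Proof.
elim: k K g h => [|k IH] K g h gh ga gb;
  have K0 := near_inverses_ge0 gh.
  have [gi _ _ _] := gh; rewrite !expr0 divr1 mulr1.
  set z := midpoint a b.
  have az : `|a - z| = 2^-1 * `|a - b|.
    by have := swap_sub a b a; rewrite swapl -/z (distrC b); lra.
  have := ler_distD (g a) (g z) z; have := ler_distD a (g a) z.
  by have := near_isometry_le z a gi; rewrite (distrC z a); lra.
have := IH _ _ _ (double_swap_near_inverses a b a b gh)
  (double_swap_fixl gh ga gb) (double_swap_fixr gh ga gb).
have := double_swap_defect a b a b gh.
rewrite !exprS invfM (mulrCA _ 2^-1).
set A := `|g _ - _|; set B := `|double_swap _ _ _ _ _ _ _ - _| => h1 h2.
have p5 : 1 <= 5 ^+ k :> R by apply: exprn_ege1; lra.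
have : K <= 5 ^+ k * K by rewrite ler_peMl.
by lra.
Qed.

(** One double swap reduces to a self-map of [X]. In the factor 6, 5 comes from the constant [5 * K]
    of that map and 1 from the defect estimate. *)
Lemma near_inverses_midpoint (R : realType) (X Y : normedModType R) (K : R)
    (f : X -> Y) (h : Y -> X) (a b : X) (k : nat) :
  near_inverses K f h ->
  `|f (midpoint a b) - midpoint (f a) (f b)|
    <= `|a - b| / 2 ^+ k + 6 * 5 ^+ k * K.
Proof.
move=> fh.
have K0 := near_inverses_ge0 fh.
have fa : `|f a - f a| <= K by rewrite subrr normr0.
have fb : `|f b - f b| <= K by rewrite subrr normr0.
have := near_fixed_midpoint k (double_swap_near_inverses a b (f a) (f b) fh)
  (double_swap_fixl fh fa fb) (double_swap_fixr fh fa fb).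
have := double_swap_defect a b (f a) (f b) fh.
set A := `|f _ - _|; set B := `|double_swap _ _ _ _ _ _ _ - _| => h1 h2.
have p5 : 1 <= 5 ^+ k :> R by apply: exprn_ege1; lra.
have : K <= 5 ^+ k * K by rewrite ler_peMl.
have : 0 <= `|a - b| / 2 ^+ k by rewrite divr_ge0 ?exprn_ge0.
by lra.
Qed.

(** * Convergence of the rescaled maps *)

(** Iterates the midpoint estimate for [0] and [2 *: v]. Each doubling of [v] is compensated by a
    halving, so the [2 ^+ k] errors add up to a factor [j]; the constant errors form a geometric
    sum, whence the outer 2. *)
Lemma near_inverses_doubling (R : realType) (X Y : normedModType R) (K : R)
    (f : X -> Y) (h : Y -> X) (v : X) (k j : nat) :
  near_inverses K f h ->
  `|f v - 2 ^- j *: f (2 ^+ j *: v)|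
    <= 2 * j%:R * `|v| / 2 ^+ k + 2 * (6 * 5 ^+ k * K + `|f 0|).
Proof.
move=> fh; elim: j v => [|j IH] v.
  rewrite expr0 invr1 !scale1r subrr normr0 mulr0 !mul0r add0r.
  have K0 := near_inverses_ge0 fh.
  have : 0 <= 5 ^+ k * K by rewrite mulr_ge0 ?exprn_ge0.
  by have := normr_ge0 (f 0); lra.
have := near_inverses_midpoint 0 (2 *: v) k fh.
rewrite /midpoint add0r scalerA mulVf // scale1r sub0r normrN normrZ gtr0_norm //.
have := IH (2 *: v); rewrite normrZ gtr0_norm //.
have -> : 2 ^+ j.+1 *: v = 2 ^+ j *: (2 *: v) by rewrite scalerA -exprSr.
have -> : 2 ^- j.+1 = 2^-1 * 2 ^- j :> R by rewrite exprS invfM.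
set F := f (2 ^+ j *: _); set G := f (2 *: v) => h1 h2.
have : `|f v - (2^-1 * 2 ^- j) *: F| <= `|f v - 2^-1 *: (f 0 + G)| +
    2^-1 * `|f 0| + 2^-1 * `|G - 2 ^- j *: F|.
  have -> : 2^-1 * `|f 0| = `|2^-1 *: f 0| by rewrite normrZ gtr0_norm.
  have -> : 2^-1 * `|G - 2 ^- j *: F| = `|2^-1 *: (G - 2 ^- j *: F)|.
    by rewrite normrZ gtr0_norm.
  have -> : f v - (2^-1 * 2 ^- j) *: F = (f v - 2^-1 *: (f 0 + G)) +
      2^-1 *: f 0 + 2^-1 *: (G - 2 ^- j *: F).
    rewrite scalerBr scalerA scalerDr opprD !addrA; congr (_ - _).
    by rewrite -addrA -(addrA (f v)) (addrC (- _)) -!addrA addKr addNr addr0.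
  by apply: le_trans (ler_normD _ _) _; rewrite lerD2r ler_normD.
rewrite -[j.+1%:R]natr1.
have p0 : 0 <= `|v| / 2 ^+ k by rewrite divr_ge0 ?exprn_ge0.
have := normr_ge0 (f 0).
by lra.
Qed.

(* Scaling by powers of 16 makes the errors [5 ^+ k * K] of order [2 ^- k]
   after division by [16 ^+ k], as needed for summability. *)
Definition asymptotic (R : realType) (X Y : normedModType R)
    (f U : X -> Y) : Prop :=
  forall (x : X) (e : R), 0 < e ->
    \forall k \near \oo, `|f (16 ^+ k *: x) - 16 ^+ k *: U x| <= e * 16 ^+ k.

Lemma near_inverses_rescale_step (R : realType) (X Y : normedModType R) (K : R)
    (f : X -> Y) (h : Y -> X) (x : X) (k : nat) :
  near_inverses K f h ->
  `|16 ^- k.+1 *: f (16 ^+ k.+1 *: x) - 16 ^- k *: f (16 ^+ k *: x)|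
    <= (8 * `|x| + 12 * K + 2 * `|f 0|) * 2^-1 ^+ k.
Proof.
move=> fh; have K0 := near_inverses_ge0 fh.
(* Four doublings make the factor 16; the precision [k] grows with the scale. *)
have := near_inverses_doubling (16 ^+ k *: x) k 4 fh.
have e16 : 2 ^+ 4 = 16 :> R by rewrite -natrX.
rewrite e16 scalerA -exprS normrZ ger0_norm ?exprn_ge0 //.
have -> : 16 ^- k.+1 = 16 ^- k * 16^-1 :> R by rewrite exprSr invfM.
rewrite -scalerA -scalerBr normrZ distrC ger0_norm ?invr_ge0 ?exprn_ge0 //.
set N := `|_ - _| => hN.
have p16 : 0 < 16 ^+ k :> R by rewrite exprn_gt0.
rewrite ler_pdivrMl // mulrC; apply: le_trans hN _.
have e2 : 2^-1 ^+ k * 16 ^+ k = 8 ^+ k :> R.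
  by rewrite -exprMn; congr (_ ^+ _); lra.
rewrite -[leRHS]mulrA e2.
have -> : 2 * 4 * (16 ^+ k * `|x|) / 2 ^+ k = 8 * `|x| * 8 ^+ k.
  by rewrite -e2 exprVn; ring.
have p5 : 5 ^+ k <= 8 ^+ k :> R by rewrite lerXn2r ?nnegrE //; lra.
have p8 : 1 <= 8 ^+ k :> R by apply: exprn_ege1; lra.
have : 5 ^+ k * K <= 8 ^+ k * K by rewrite ler_wpM2r.
have : `|f 0| <= 8 ^+ k * `|f 0| by rewrite ler_peMl.
lra.
Qed.

(** The increments are dominated by a geometric series, so the telescoping series converges in the
    complete space [Y]. *)
Lemma near_inverses_asymptotic (R : realType) (X : normedModType R)
    (Y : completeNormedModType R) (K : R) (f : X -> Y) (h : Y -> X) :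
  near_inverses K f h -> exists U : X -> Y, asymptotic f U.
Proof.
move=> fh.
suff /choice[U UP] : forall x, exists l : Y,
    16 ^- k *: f (16 ^+ k *: x) @[k --> \oo] --> l.
  exists U => x e e0.
  have /cvgrPdist_le/(_ e e0) := UP x; apply: filterS => k.
  have p16 : 0 < 16 ^+ k :> R by rewrite exprn_gt0.
  rewrite distrC -(ler_pM2r p16) mulrC -[X in X * _ <= _](gtr0_norm p16) -normrZ.
  by rewrite scalerBr scalerA divff ?gt_eqF // scale1r.
move=> x; pose u k := 16 ^- k *: f (16 ^+ k *: x).
suff : cvgn u by move=> cu; exists (limn u).
have -> : u = (fun n => u 0%N + series (telescope u) n).
  by apply/funext => n; rewrite -eq_sum_telescope.
apply: is_cvgD; first exact: is_cvg_cst.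
apply: normed_cvg.
set C := 8 * `|x| + 12 * K + 2 * `|f 0|.
have K0 := near_inverses_ge0 fh.
have C0 : 0 <= C by rewrite !addr_ge0 ?mulr_ge0.
apply: (@series_le_cvg R _ (geometric C 2^-1)) => [n|n|n|].
- exact: normr_ge0.
- by rewrite /= mulr_ge0 ?exprn_ge0.
- exact: near_inverses_rescale_step fh.
- by apply: is_cvg_geometric_series; rewrite ger0_norm //; lra.
Qed.

(** * The limit as a bijective linear isometry *)

Lemma ler_gt0_scaled (R : realType) (a C : R) :
  (forall e, 0 < e -> a <= C * e) -> a <= 0.
Proof.
move=> H; rewrite leNgt; apply/negP => a0.
have C1 : 0 < `|C| + 1 by have := normr_ge0 C; lra.
have := H (a / (2 * (`|C| + 1))); rewrite divr_gt0 ?mulr_gt0 // => /(_ isT).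
have : C * (a / (2 * (`|C| + 1))) <= (`|C| + 1) * (a / (2 * (`|C| + 1))).
  by rewrite ler_wpM2r ?divr_ge0 ?mulr_ge0 // ?ltW //; have := ler_norm C; lra.
have -> : (`|C| + 1) * (a / (2 * (`|C| + 1))) = a / 2 by field; rewrite gt_eqF.
lra.
Qed.

Lemma near_exp16_ge (R : realType) (M : R) : \forall k \near \oo, M <= 16 ^+ k.
Proof.
near=> k; apply: (@le_trans _ _ (k%:R : R)).
  by near: k; exact: nbhs_infty_ger.
by rewrite -natrX ler_nat ltnW // ltn_expl.
Unshelve. all: by end_near. Qed.

Lemma asymptotic_isometry (R : realType) (X Y : normedModType R) (K : R)
    (f U : X -> Y) :
  near_isometry K f -> asymptotic f U -> is_isometry U.
Proof.
move=> fi fU x y; apply/eqP; rewrite -subr_eq0 -normr_le0.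
apply: (@ler_gt0_scaled _ _ 3) => e e0.
suff [k] : exists k, [/\ `|f (16 ^+ k *: x) - 16 ^+ k *: U x| <= e * 16 ^+ k,
   `|f (16 ^+ k *: y) - 16 ^+ k *: U y| <= e * 16 ^+ k & K / e <= 16 ^+ k].
  have p16 : 0 < 16 ^+ k :> R by rewrite exprn_gt0.
  have nE (Z : normedModType R) (a b : Z) :
      `|16 ^+ k *: a - 16 ^+ k *: b| = `|a - b| * 16 ^+ k.
    by rewrite -scalerBr normrZ gtr0_norm // mulrC.
  rewrite ler_pdivrMr // (mulrC _ e) => -[hx hy hK].
  have := fi (16 ^+ k *: x) (16 ^+ k *: y); rewrite nE ler_norml => /andP[h5 h6].
  have := ler_distD (f (16 ^+ k *: x)) (16 ^+ k *: U x) (16 ^+ k *: U y).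
  have := ler_distD (f (16 ^+ k *: y)) (f (16 ^+ k *: x)) (16 ^+ k *: U y).
  have := ler_distD (16 ^+ k *: U x) (f (16 ^+ k *: x)) (f (16 ^+ k *: y)).
  have := ler_distD (16 ^+ k *: U y) (16 ^+ k *: U x) (f (16 ^+ k *: y)).
  rewrite nE (distrC (16 ^+ k *: U x) (f (16 ^+ k *: x))).
  rewrite (distrC (16 ^+ k *: U x)) (distrC (16 ^+ k *: U y)).
  move=> h1 h2 h3 h4.
  rewrite -(ler_pM2r p16) -[X in _ * X <= _](gtr0_norm p16) -normrM.
  by rewrite ler_norml; apply/andP; split; lra.
near \oo => k; exists k; split; near: k; [exact: fU|exact: fU|exact: near_exp16_ge].
Unshelve. all: by end_near. Qed.

(** The precision of the midpoint estimate is taken equal to the exponent [k] of the scale: divided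
    by [16 ^+ k], both error terms tend to 0. *)
Lemma asymptotic_midpoint (R : realType) (X Y : normedModType R) (K : R)
    (f U : X -> Y) (h : Y -> X) (x y : X) :
  near_inverses K f h -> asymptotic f U ->
  U (midpoint x y) = midpoint (U x) (U y).
Proof.
move=> fh fU; have K0 := near_inverses_ge0 fh.
apply/eqP; rewrite -subr_eq0 -normr_le0.
apply: (@ler_gt0_scaled _ _ (2 + `|x - y| + 6 * K)) => e e0.
suff [k] : exists k, [/\ `|f (16 ^+ k *: x) - 16 ^+ k *: U x| <= e * 16 ^+ k,
   `|f (16 ^+ k *: y) - 16 ^+ k *: U y| <= e * 16 ^+ k,
   `|f (16 ^+ k *: midpoint x y) - 16 ^+ k *: U (midpoint x y)| <= e * 16 ^+ k
   & 2^-1 ^+ k <= e].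
  have p16 : 0 < 16 ^+ k :> R by rewrite exprn_gt0.
  have -> : 16 ^+ k *: midpoint x y = midpoint (16 ^+ k *: x) (16 ^+ k *: y).
    by rewrite /midpoint -scalerDr !scalerA mulrC.
  set z := midpoint (16 ^+ k *: x) _; set m := U (midpoint x y).
  move=> [hx hy hz he].
  have := near_inverses_midpoint (16 ^+ k *: x) (16 ^+ k *: y) k fh.
  rewrite -scalerBr normrZ gtr0_norm // -/z => hm.
  have hm2 : `|midpoint (f (16 ^+ k *: x)) (f (16 ^+ k *: y)) -
      16 ^+ k *: midpoint (U x) (U y)| <= e * 16 ^+ k.
    have -> : midpoint (f (16 ^+ k *: x)) (f (16 ^+ k *: y)) -
      16 ^+ k *: midpoint (U x) (U y) =
      2^-1 *: ((f (16 ^+ k *: x) - 16 ^+ k *: U x) +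
               (f (16 ^+ k *: y) - 16 ^+ k *: U y)).
      rewrite /midpoint scalerA mulrC -scalerA -scalerBr; congr (_ *: _).
      by rewrite scalerDr opprD addrACA.
    rewrite normrZ gtr0_norm //.
    have := ler_normD (f (16 ^+ k *: x) - 16 ^+ k *: U x)
               (f (16 ^+ k *: y) - 16 ^+ k *: U y).
    lra.
  rewrite -(ler_pM2l p16) -[X in X * _ <= _](gtr0_norm p16) -normrZ scalerBr.
  have := ler_distD (f z) (16 ^+ k *: m) (16 ^+ k *: midpoint (U x) (U y)).
  have := ler_distD (midpoint (f (16 ^+ k *: x)) (f (16 ^+ k *: y)))
            (f z) (16 ^+ k *: midpoint (U x) (U y)).
  rewrite (distrC _ (f z)).
  have h1 : 16 ^+ k * `|x - y| / 2 ^+ k <= 16 ^+ k * `|x - y| * e.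
    by rewrite -exprVn ler_wpM2l // mulr_ge0 // ltW.
  have h2 : 5 ^+ k * K <= 16 ^+ k * (e * K).
    rewrite mulrA ler_wpM2r //; apply: (@le_trans _ _ (16 ^+ k * 2^-1 ^+ k)).
      by rewrite -exprMn lerXn2r ?nnegrE //; lra.
    by rewrite ler_pM2l.
  lra.
have half : \forall k \near \oo, 2^-1 ^+ k <= e.
  have : (fun k => 2^-1 ^+ k : R) @ \oo --> (0 : R).
    by apply: cvg_expr; rewrite ger0_norm //; lra.
  move=> /cvgrPdist_le/(_ e e0); apply: filterS => k.
  by rewrite sub0r normrN; apply: le_trans; exact: ler_norm.
near \oo => k; exists k; split; near: k; [exact: fU|exact: fU|exact: fU|exact: half].
Unshelve. all: by end_near. Qed.

(** At large scale [h] is close to [V], so [f] after [V] is close to [f] after [h], which is the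
    identity up to [K]. *)
Lemma asymptotic_cancel (R : realType) (X Y : normedModType R) (K : R)
    (f U : X -> Y) (h V : Y -> X) :
  near_inverses K f h -> asymptotic f U -> asymptotic h V -> cancel V U.
Proof.
move=> [fi _ _ fhK] fU hV y; apply/eqP; rewrite -subr_eq0 -normr_le0.
apply: (@ler_gt0_scaled _ _ 4) => e e0.
suff [k] : exists k,
   [/\ `|f (16 ^+ k *: V y) - 16 ^+ k *: U (V y)| <= e * 16 ^+ k,
   `|h (16 ^+ k *: y) - 16 ^+ k *: V y| <= e * 16 ^+ k & K / e <= 16 ^+ k].
  have p16 : 0 < 16 ^+ k :> R by rewrite exprn_gt0.
  rewrite ler_pdivrMr // (mulrC _ e) => -[hx hy hK].
  rewrite -(ler_pM2l p16) -[X in X * _ <= _](gtr0_norm p16) -normrZ scalerBr.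
  have := near_isometry_le (h (16 ^+ k *: y)) (16 ^+ k *: V y) fi.
  have := ler_distD (f (16 ^+ k *: V y)) (16 ^+ k *: U (V y)) (16 ^+ k *: y).
  have := ler_distD (f (h (16 ^+ k *: y))) (f (16 ^+ k *: V y)) (16 ^+ k *: y).
  rewrite (distrC (f (16 ^+ k *: V y)) (f _)) (distrC (16 ^+ k *: U _) (f _)).
  by have := fhK (16 ^+ k *: y); lra.
near \oo => k; exists k; split; near: k; [exact: fU|exact: hV|exact: near_exp16_ge].
Unshelve. all: by end_near. Qed.

(** Midpoints with [0] give additivity, hence homogeneity for integers; real scalars follow by
    rounding. *)
Lemma midpoint_isometry_linear (R : realType) (X Y : normedModType R)
    (U : X -> Y) :
  is_isometry U -> U 0 = 0 ->
  (forall x y, U (midpoint x y) = midpoint (U x) (U y)) -> linear U.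
Proof.
move=> Ui U0 Um.
have UD x y : U (x + y) = U x + U y.
  apply: (@scalerI _ _ (2^-1 : R)); first by rewrite invr_eq0 pnatr_eq0.
  transitivity (midpoint (U (x + y)) (U 0)); first by rewrite /midpoint U0 addr0.
  rewrite -Um; transitivity (U (midpoint x y)); last exact: Um.
  by rewrite /midpoint addr0.
have UN x : U (- x) = - U x.
  by apply/eqP; rewrite -addr_eq0 -UD addNr U0.
have Un n x : U (n%:R *: x) = n%:R *: U x.
  elim: n => [|n IH]; first by rewrite !scale0r.
  by rewrite -natr1 !scalerDl !scale1r UD IH.
have Upos (a : R) x : 0 <= a -> U (a *: x) = a *: U x.
  move=> a0; apply/eqP; rewrite -subr_eq0 -normr_le0.
  apply: (@ler_gt0_scaled _ _ (2 * `|x|)) => e e0.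
  (* Rounding [n * a] to the integer [m] costs at most [|x|] on either side; dividing by [n] makes
     this at most [e * |x|]. *)
  pose n := (Num.truncn e^-1).+1; pose m := Num.truncn (n%:R * a).
  have n0 : 0 < n%:R :> R by rewrite ltr0n.
  have en : 1 <= n%:R * e.
    rewrite -ler_pdivrMr // div1r ltW //.
    by rewrite truncnS_gt.
  have /andP[m1 m2] : m%:R <= n%:R * a < m.+1%:R.
    by apply: truncn_itv; rewrite mulr_ge0.
  have am : `|n%:R * a - m%:R| <= 1.
    by move: m2; rewrite -natr1 ler_norml => ?; apply/andP; split; lra.
  have Ux : `|U x| = `|x| by have := Ui x 0; rewrite U0 !subr0.
  rewrite -(ler_pM2l n0) -[X in X * _ <= _](gtr0_norm n0) -normrZ scalerBr.
  rewrite -Un !scalerA.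
  have := ler_distD (m%:R *: U x) (U ((n%:R * a) *: x)) ((n%:R * a) *: U x).
  rewrite -{1}Un Ui -!scalerBl !normrZ (distrC m%:R) Ux.
  have : `|n%:R * a - m%:R| * `|x| <= 1 * `|x| by rewrite ler_wpM2r.
  have : 1 * `|x| <= n%:R * e * `|x| by rewrite ler_wpM2r.
  lra.
move=> a x y; rewrite UD; congr (_ + _).
have [a0|a0] := leP 0 a; first exact: Upos.
have na : 0 <= - a by rewrite oppr_ge0 ltW.
by rewrite -[a in LHS]opprK scaleNr UN Upos // scaleNr opprK.
Qed.

(** * The sharp bound on the deviation *)

(* Convexity, in the form
   [(`|z| - `|z - T *: x|) / T <= `|z| - `|z - x|] without division. *)
Lemma norm_step (R : realType) (X : normedModType R) (z x : X) (T : R) :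
  1 <= T -> T * `|z - x| <= (T - 1) * `|z| + `|z - T *: x|.
Proof.
move=> T1; rewrite -[T in T * _]ger0_norm; last lra.
rewrite -[T - 1]ger0_norm; last lra.
rewrite -!normrZ; apply: le_trans (ler_normD _ _).
by rewrite scalerBr addrA scalerBl scale1r subrK.
Qed.

(** Convexity is used in both spaces with step [T = N * t]. The near-isometry inequality enters [T]
    times for the pair [z], [x] and [T] times for [z], [0]; after division by [N] this is
    [2 * eps * t]. *)
Lemma asymptotic_second_difference (R : realType) (X Y : normedModType R)
    (eps : R) (f U : X -> Y) (u x : X) (t : R) :
  near_isometry eps f -> f 0 = 0 -> asymptotic f U -> `|U u| = `|u| -> 0 < t ->
  2 * `|u| <= `|u + t *: x| + `|U u - t *: f x| + 2 * eps * t.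
Proof.
move=> fi f0 fU Uu t0; rewrite -subr_le0.
apply: (@ler_gt0_scaled _ _ 2) => e e0.
suff [k] : exists k,
   `|f (16 ^+ k *: u) - 16 ^+ k *: U u| <= e * 16 ^+ k /\ t^-1 <= 16 ^+ k.
  set N := 16 ^+ k; have p16 : 0 < N by rewrite exprn_gt0.
  move=> [hu]; rewrite -div1r ler_pdivrMr // => T1.
  set z := N *: u in hu *; set T := N * t in T1 *.
  have zE : `|z| = N * `|u| by rewrite normrZ gtr0_norm.
  have h1 : `|z + T *: x| = N * `|u + t *: x|.
    by rewrite -[X in _ = X * _](gtr0_norm p16) -normrZ scalerDr scalerA.
  have h2 : `|N *: U u - T *: f x| = N * `|U u - t *: f x|.
    by rewrite -[X in _ = X * _](gtr0_norm p16) -normrZ scalerBr scalerA.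
  have h3 : `|N *: U u| = N * `|u| by rewrite normrZ gtr0_norm // Uu.
  have h4 := near_isometry_ge z x fi.
  have h5 := near_isometry_le z 0 fi; rewrite f0 !subr0 in h5.
  have h6 := norm_step (f z) (f x) T1.
  (* [z] is the mean of [z - x] and [z + T *: x] with weights [T] and 1. *)
  have h7 : (T + 1) * `|z| <= T * `|z - x| + `|z + T *: x|.
    rewrite -[T + 1]ger0_norm; last lra.
    rewrite -{2}[T]ger0_norm; last lra.
    rewrite -!normrZ; apply: le_trans (ler_normD _ _).
    by rewrite scalerBr addrA addrAC subrK scalerDl scale1r.
  have h8 := ler_distD (N *: U u) (f z) (T *: f x).
  have h9 : `|N *: U u| <= `|f z| + `|f z - N *: U u|.
    by have := ler_distD (f z) (N *: U u) 0; rewrite !subr0 distrC addrC.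
  have h10 : T * `|f z| <= T * (`|z| + eps) by rewrite ler_wpM2l //; lra.
  have h11 : T * `|z - x| <= T * (`|f z - f x| + eps).
    by rewrite ler_wpM2l //; lra.
  rewrite -(ler_pM2l p16).
  have TE : T * eps = N * (eps * t) by rewrite /T; ring.
  lra.
near \oo => k; exists k; split; near: k; [exact: fU|exact: near_exp16_ge].
Unshelve. all: by end_near. Qed.

(* The second differences along the equidistant points [w + (i * t) *: x]
   telescope to a difference of two slopes, each at most [`|x|]; hence one of
   them is small. *)
Lemma norm_small_second_difference (R : realType) (X : normedModType R)
    (w x : X) (eta : R) :
  0 < eta <= 1 -> exists t v, [/\ 0 < t <= 1, `|v - w| <= eta * `|x| &
    `|v + (2 * t) *: x| + `|v| <= 2 * `|v + t *: x| + eta * t].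
Proof.
move=> /andP[eta0 eta1].
(* Large enough that [m] increments of the slope, [eta] each, exceed the available [2 * |x|]. *)
pose m := (Num.truncn (2 * `|x| / eta)).+1.
have m0 : 0 < m%:R :> R by rewrite ltr0n.
have hm : 2 * `|x| < m%:R * eta.
  rewrite -ltr_pdivrMr //.
  exact: truncnS_gt.
pose t := eta / m%:R.
have t0 : 0 < t by rewrite divr_gt0.
have tm : m%:R * t = eta by rewrite /t mulrC divfK // gt_eqF.
have m1 : 1 <= m%:R :> R by rewrite ler1n.
have t1 : t <= 1 by rewrite ler_pdivrMr //; lra.
pose a i := `|w + (i%:R * t) *: x|.
apply: contrapT => no.
have big i : (i < m)%N -> 2 * a i.+1 + eta * t <= a i.+2 + a i.
  move=> im; rewrite leNgt; apply/negP => hi; apply: no.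
  exists t, (w + (i%:R * t) *: x); split; first by rewrite t0.
    rewrite addrC addKr normrZ ler_wpM2r // ger0_norm; last by rewrite mulr_ge0 // ltW.
    by rewrite -tm ler_pM2r // ler_nat ltnW.
  rewrite -!addrA -!(scalerDl x).
  have -> : i%:R * t + 2 * t = i.+2%:R * t by rewrite -(natr1 i.+1) -natr1; ring.
  have -> : i%:R * t + t = i.+1%:R * t by rewrite -natr1; ring.
  by apply: ltW; move: hi; rewrite /a; lra.
have step i : `|a i.+1 - a i| <= t * `|x|.
  apply: le_trans (ler_dist_dist _ _) _.
  rewrite opprD addrACA subrr add0r -scalerBl -natr1 mulrDl mul1r addrC addKr.
  by rewrite normrZ gtr0_norm.
have sum i : (i <= m)%N -> a 1%N - a 0%N + i%:R * (eta * t) <= a i.+1 - a i.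
  elim: i => [|i IH] im; first by rewrite mul0r addr0.
  by have := IH (ltnW im); have := big i im; rewrite -natr1; lra.
have := sum m (leqnn m); have := step m; have := step 0%N.
rewrite !ler_norml => /andP[h1 h2] /andP[h3 h4] h5.
have : t * (2 * `|x|) < t * (m%:R * eta) by rewrite ltr_pM2l.
lra.
Qed.

Lemma asymptotic_isometry_bound (R : realType) (X Y : normedModType R)
    (eps : R) (f : X -> Y) (U : {linear X -> Y}) (x w : X) :
  near_isometry eps f -> f 0 = 0 -> asymptotic f U -> is_isometry U ->
  U w = f x - U x -> `|w| <= 2 * eps.
Proof.
move=> fi f0 fU Ui Uw.
have Un z : `|U z| = `|z| by have := Ui z 0; rewrite linear0 !subr0.
have key eta : 0 < eta <= 1 -> `|w| <= 2 * eps + eta * (1 + 2 * `|x|).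
  move=> eta01; have [t [v [/andP[t0 t1] vw sd]]] :=
    norm_small_second_difference w x eta01.
  have := asymptotic_second_difference x fi f0 fU (Un (v + t *: x)) t0.
  rewrite -(addrA v) -scalerDl -mulr2n -[t *+ 2]mulr_natl.
  (* Applied at [u = v + t *: x], the two norms at [v + t *: x] and [v + (2 * t) *: x] cancel
     against [sd], leaving [v] and [v - t *: w]. *)
  have -> : U (v + t *: x) - t *: f x = U (v - t *: w).
    rewrite [U (v + _)]linearD [U (v - _)]linearB !linearZ /= Uw.
    by rewrite opprB -addrA -scalerDr.
  rewrite Un => h1.
  have h2 : `|v - t *: w| <= (1 - t) * `|v| + t * `|v - w|.
    rewrite -[1 - t]ger0_norm; last lra.
    rewrite -[X in X * `|v - w|]gtr0_norm // -!normrZ.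
    apply: le_trans (ler_normD _ _).
    by rewrite scalerBr addrA scalerBl scale1r subrK.
  have h3 : `|v| <= eta + 2 * eps + `|v - w|.
    by rewrite -(ler_pM2l t0); lra.
  have h4 := ler_distD v w 0; rewrite !subr0 (distrC w v) in h4.
  lra.
rewrite -subr_le0; apply: (@ler_gt0_scaled _ _ (1 + 2 * `|x|)) => e e0.
(* [key] needs [eta <= 1]; larger [e] follow from [eta = 1]. *)
have [e1|e1] := leP e 1; first by have := key e; rewrite e0 e1 => /(_ isT); lra.
have := key 1; rewrite ltr01 lexx => /(_ isT).
have : 1 * (1 + 2 * `|x|) <= e * (1 + 2 * `|x|).
  by rewrite ler_wpM2r ?ltW // addr_gt0 ?mulr_ge0.
lra.
Qed.

(** * Optimality of the constant 2 *)

Definition fold_line (R : realType) (x : R) : R :=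
  if 0 <= x <= 2^-1 then - 3 * x else x - 1.

(** On the segment the map differs from the translation [x - 1] by at most 1 and triples distances,
    adding [2 * |x - y| <= 1]; elsewhere it is that translation. *)
Lemma fold_line_near_isometry (R : realType) :
  near_isometry 1 (@fold_line R : R -> R).
Proof.
move=> x y; rewrite /fold_line ler_norml.
by case: ifPn; case: ifPn; rewrite ?negb_and -?ltNge;
  do ?[move=> /andP[? ?]|move=> /orP[] ?];
  case: ger0P => ?; case: ger0P => ?; apply/andP; split; lra.
Qed.

Lemma fold_line_near_surjective (R : realType) :
  near_surjective (@fold_line R : R -> R).
Proof.
exists 2; first by []; move=> y; exists y; rewrite /fold_line ler_norml.
by case: ifPn => [/andP[? ?]|_]; apply/andP; split; lra.
Qed.

(** The linear isometries of the line are the identity, missed by exactly 2 at [1/2], and its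
    negative, missed by 5 at 3. *)
Lemma fold_line_far (R : realType) (c : R) (U : {linear R -> R}) :
  c < 2 -> is_isometry U -> exists x, c < `|fold_line x - U x|.
Proof.
move=> c2 Ui.
have UE x : U x = x * U 1 by rewrite -{1}[x]mulr1 -[x * 1]/(x *: (1 : R^o)) linearZ.
have U1 : `|U 1| = 1 by have := Ui 1 0; rewrite linear0 !subr0 normr1.
have [U0|U0] := leP 0 (U 1).
  have {}U1 : U 1 = 1 by rewrite ger0_norm in U1.
  exists 2^-1; rewrite UE U1 /fold_line ifT; last by apply/andP; split; lra.
  by rewrite ltr0_norm; lra.
have {}U1 : U 1 = - 1.
  by apply: oppr_inj; rewrite opprK -[RHS]U1 ltr0_norm.
exists 3; rewrite UE U1 /fold_line ifF; last by apply/negP => /andP[_]; lra.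
by rewrite gtr0_norm; lra.
Qed.

Theorem theorem3p5 (R : realType) :
  (forall (X Y : completeNormedModType R) (eps : R) (f : X -> Y),
      0 <= eps ->
      near_isometry eps f ->
      near_surjective f ->
      f 0 = 0 ->
      (exists U : {linear X -> Y},
          [/\ bijective U, is_isometry U &
              forall x : X, `|f x - U x| <= 2 * eps]) /\
      near_surjective_by (2 * eps) f) /\
  (forall c : R, c < 2 ->
      exists (X Y : completeNormedModType R) (eps : R) (f : X -> Y),
        [/\ 0 <= eps, near_isometry eps f, near_surjective f, f 0 = 0 &
            ~ exists U : {linear X -> Y},
                [/\ bijective U, is_isometry U &
                    forall x : X, `|f x - U x| <= c * eps]]).
Proof.
split=> [X Y eps f eps0 fi fs f0|c c2].
  suff [U [Ub Ui Uf]] : exists U : {linear X -> Y},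
      [/\ bijective U, is_isometry U & forall x : X, `|f x - U x| <= 2 * eps].
    split; first by exists U.
    by move=> y; have [V _ VK] := Ub; exists (V y); rewrite -{2}(VK y).
  have [K [h fh]] := near_surjective_near_inverse fi fs.
  have [U fU] := near_inverses_asymptotic fh.
  have hf := near_inverses_sym fh.
  have [V hV] := near_inverses_asymptotic hf.
  have Ui := asymptotic_isometry fi fU.
  have VK := asymptotic_cancel fh fU hV.
  have UK := asymptotic_cancel hf hV fU.
  have U0 : U 0 = 0.
    apply/eqP; rewrite -normr_le0; apply: (@ler_gt0_scaled _ _ 1) => e e0.
    have [k _ /(_ k (leqnn k))] := fU 0 e e0.
    have p16 : 0 < 16 ^+ k :> R by rewrite exprn_gt0.
    rewrite /= scaler0 f0 sub0r normrN normrZ gtr0_norm // mulrC.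
    by rewrite ler_pM2r // mul1r.
  have Ulin : linear U.
    by apply: midpoint_isometry_linear => // x y; apply: asymptotic_midpoint fh fU.
  pose L := GRing.isLinear.Build R X Y *:%R U Ulin.
  pose U' : {linear X -> Y} := HB.pack U L.
  exists U'; split=> //; first by exists V.
  (* Surjectivity of [U] turns the deviation into a vector of [X], of the same norm. *)
  move=> x; pose w := V (f x - U x).
  have Uw : U' w = f x - U' x by rewrite /w /= VK.
  rewrite -Uw; have := Ui w 0; rewrite U0 !subr0 => ->.
  exact: (asymptotic_isometry_bound fi f0 _ _ Uw).
exists R, R, 1, (@fold_line R); split=> //.
- exact: fold_line_near_isometry.
- exact: fold_line_near_surjective.
- by rewrite /fold_line ifT ?mulr0 //; apply/andP; split; lra.
- move=> [U [_ Ui Uf]]; have [x] := fold_line_far c2 Ui.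
  by rewrite ltNge; have := Uf x; rewrite mulr1 => ->.
Qed.
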